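(* Let $X$ be a nonempty subset of $\mathbb{R}^n$, let $f_i, g_j : X\to\mathbb{R}$ ($i=1,\dots,p$, $j=1,\dots,m$), and let $\Omega=\{x\in X : g_j(x)\leqslant 0,\ j=1,\dots,m\}$. If $f_1,\dots,f_p$ are Lipschitz on $\Omega$, then every point of $\Omega$ is a quasi efficient solution of the problem $(VP)$ of minimizing $(f_1(x),\dots,f_p(x))$ over $x\in\Omega$.
   Context: Notation: $\operatorname{int}(\mathbb{R}^p_+)$ is the set of vectors in $\mathbb{R}^p$ with all components positive. Lipschitz on $\Omega$: a function $h$ is Lipschitz on $\Omega$ if there exists $L\geqslant 0$ such that $|h(y)-h(z)|\leqslant L\|y-z\|$ for all $y,z\in\Omega$. Quasi efficient solution: a feasible point $x_\circ\in\Omega$ is a quasi efficient solution of $(VP)$ if there exists $\alpha\in\operatorname{int}(\mathbb{R}^p_+)$ such that for any $x\in\Omega$ the following cannot hold (simultaneously): $$f_i(x)\leqslant f_i(x_\circ)-\alpha_i\|x-x_\circ\|\quad\text{for all } i=1,\dots,p,$$ $$f_r(x)<f_r(x_\circ)-\alpha_r\|x-x_\circ\|\quad\text{for some } r\in\{1,\dots,p\}.$$ *)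

(* Defs.v *)
From mathcomp Require Import all_boot all_order all_algebra.
From mathcomp Require Import boolp classical_sets reals.
Set Implicit Arguments.
Unset Strict Implicit.
Unset Printing Implicit Defensive.
Import Order.TTheory GRing.Theory Num.Theory.
Local Open Scope classical_set_scope.
Local Open Scope ring_scope.

(* The norm `|x| that MathComp-Analysis puts on 'rV[R]_n is the sup norm, so
   the Euclidean norm has to be defined. *)
Definition enorm (R : realType) (n : nat) (x : 'rV[R]_n) : R :=
  Num.sqrt (\sum_(i < n) x 0 i ^+ 2).

Definition int_orthant (R : realType) (p : nat) : set 'rV[R]_p :=
  [set a | forall i, 0 < a 0 i].

(* The objectives and constraints are defined on X only: they are functions on
   the subtype of X, and \val injects that subtype into 'rV[R]_n. *)
Definition feasible (R : realType) (n m : nat) (X : set 'rV[R]_n)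
    (g : 'I_m -> X -> R) : set X :=
  [set x | forall j, g j x <= 0].

(* MathComp-Analysis's [lipschitz _ | _ in _] would use the sup norm and
   requires the function to be defined on the whole space. *)
Definition lipschitz_on_set (R : realType) (n : nat) (X : set 'rV[R]_n)
    (A : set X) (h : X -> R) : Prop :=
  exists2 L : R, 0 <= L &
    forall y z : X, A y -> A z -> `|h y - h z| <= L * enorm (\val y - \val z).

Definition quasi_efficient (R : realType) (n p m : nat) (X : set 'rV[R]_n)
    (f : 'I_p -> X -> R) (g : 'I_m -> X -> R) (x0 : X) : Prop :=
  feasible g x0 /\
  exists2 alpha : 'rV[R]_p, int_orthant alpha &
    forall x : X, feasible g x ->
      ~ ((forall i : 'I_p,
            f i x <= f i x0 - alpha 0 i * enorm (\val x - \val x0)) /\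
         (exists r : 'I_p,
            f r x < f r x0 - alpha 0 r * enorm (\val x - \val x0))).

(* Main.v *)
Require Import Defs.
From mathcomp Require Import all_boot all_order all_algebra.
From mathcomp Require Import boolp classical_sets reals.
Import Order.TTheory GRing.Theory Num.Theory.
Local Open Scope classical_set_scope.
Local Open Scope ring_scope.

(** If each [f i] is Lipschitz with constant [L i], moving from [x0] to [x]
    lowers [f i] by at most [L i] times the distance. With the weights
    [alpha i := L i + 1], which are positive even when [L i = 0], a drop of
    more than [alpha r] times the distance is impossible in any single
    component [r]: the strict inequality cannot hold. *)

Theorem mainTheorem3 (R : realType) (n p m : nat) (X : set 'rV[R]_n)
    (X_nonempty : X !=set0) (f : 'I_p -> X -> R) (g : 'I_m -> X -> R)
    (f_lipschitz : forall i : 'I_p, lipschitz_on_set (feasible g) (f i)) :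
  forall x0 : X, feasible g x0 -> quasi_efficient f g x0.
Proof.
move=> x0 x0_feasible; split=> //.
pose L i := projT1 (cid2 (f_lipschitz i)).
have L_ge0 i : 0 <= L i by rewrite /L; case: cid2.
have L_lip i x : feasible g x ->
    `|f i x0 - f i x| <= L i * enorm (\val x - \val x0).
  by rewrite distrC /L; case: cid2 => l /= _ lip x_feasible; apply: lip.
exists (\row_i (L i + 1)) => [i | x x_feasible [_ [r]]].
  by rewrite mxE ltr_wpDl.
apply/negP; rewrite -leNgt mxE lerBlDr -lerBlDl.
apply: le_trans (ler_norm _) (le_trans (L_lip r x x_feasible) _).
by rewrite ler_wpM2r ?sqrtr_ge0 // lerDl.
Qed.
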